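(* Consider the $M/M/n$ queue with service rate $\mu>0$ per server and arrival rate $\lambda_n=n\mu(1-\epsilon_n)$, and let $w_n$ be the steady-state number of waiting customers. Then, for any sequence $\{\epsilon_n\}$ such that $\epsilon_n\to0$ as $n\to\infty$, and for any $\theta<1$, $$\lim_{n\to\infty}\mathbb E\big[e^{\theta\epsilon_nw_n}\,\big|\,w_n>0\big]=\frac1{1-\theta},\qquad [\epsilon_nw_n\mid w_n>0]\xrightarrow{d}\Upsilon,$$ where $\Upsilon$ is an exponential random variable with mean $1$. Further, for any $x>\epsilon_n$, $$\frac{1}{(1-\epsilon_n)^2}\,e^{-\theta_nx}\le\mathbb P(\epsilon_nw_n\ge x\mid w_n>0)\le\frac1{1-\epsilon_n}\,e^{-\theta_nx},$$ where $\theta_n=\frac1{\epsilon_n}\log\frac1{1-\epsilon_n}$. As a consequence, we get the large deviation result $$\lim_{x\to\infty}-\frac1x\log\mathbb P(\epsilon_nw_n\ge x)=\lim_{x\to\infty}-\frac1x\log\mathbb P(\epsilon_nw_n\ge x\mid w_n>0)=\theta_n.$$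
   Context: $M/M/n$ queue: $n$ servers, a single first-come-first-served queue, Poisson arrivals of rate $\lambda_n$, and exponentially distributed service times of rate $\mu$ at each server. $q_n(t)$ is the number of customers in the system at time $t$; it is a continuous-time Markov chain, positive recurrent when $\lambda_n<n\mu$ (which is assumed, so $\epsilon_n>0$). $q_n$ denotes a variable with its stationary distribution, and $w_n=[q_n-n]^+$ is the steady-state number of customers waiting in the queue, with $[y]^+=\max\{y,0\}$. $[\epsilon_nw_n\mid w_n>0]$ denotes a random variable with the conditional law of $\epsilon_nw_n$ given $w_n>0$, and $\xrightarrow{d}$ denotes convergence in distribution.
   Formalization: The printed lower bound with constant 1/(1-ε_n)^2 exceeds the printed upper bound with constant 1/(1-ε_n), so it is false for every 0<ε_n<1; the formal statement proves the lower bound e^{-θ_n x} (constant 1, the sharp one) instead. *)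

(* Defs.v *)
From HB Require Export structures.
From mathcomp Require Export all_boot all_order all_algebra.
From mathcomp Require Export all_classical all_reals all_analysis.
Export Order.TTheory GRing.Theory Num.Theory.
Export numFieldNormedType.Exports.

Set Implicit Arguments.
Unset Strict Implicit.
Unset Printing Implicit Defensive.

Local Open Scope classical_set_scope.
Local Open Scope ring_scope.

(* A continuous-time Markov chain on nat is given by its Markov transition
   function [P]: [P t i A] is the probability of being in [A] at time [s + t]
   when in state [i] at time [s]. Only the times [t >= 0] are meaningful. *)
Definition transition_function (R : realType)
    (P : R -> R.-pker nat ~> nat) : Prop :=
  (forall i A, P 0 i A = \d_i A) /\
  (forall s t, 0 <= s -> 0 <= t -> forall i A,
     P (s + t) i A = (\int[P s i]_k P t k A)%E).

(* The chain jumps with rates [Q]: as [h] decreases to 0, the probability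
   of going from [i] to [j] in time [h] is [(i == j)%:R + Q i j * h + o(h)]. *)
Definition has_rates (R : realType) (P : R -> R.-pker nat ~> nat)
    (Q : nat -> nat -> R) : Prop :=
  forall i j,
    (fine (P h i [set j]) - (i == j)%:R) / h @[h --> 0^'+] --> Q i j.

(* Of [i] customers in the system, [minn i n] are in service. The diagonal
   entries make the rows of the rate matrix sum to 0. *)
Definition mmn_rates (R : realType) (n : nat) (lam mu : R) (i j : nat) : R :=
  if j == i.+1 then lam
  else if i == j.+1 then (minn i n)%:R * mu
  else if i == j then - (lam + (minn i n)%:R * mu)
  else 0.

Definition mmn_chain (R : realType) (n : nat) (lam mu : R)
    (P : R -> R.-pker nat ~> nat) : Prop :=
  transition_function P /\ has_rates P (mmn_rates n lam mu).

Definition stationary (R : realType) (P : R -> R.-pker nat ~> nat)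
    (pi : probability nat R) : Prop :=
  forall t, 0 <= t -> forall A, (\int[pi]_i P t i A)%E = pi A.

(* [q - n]^+ : the subtraction on nat is truncated at 0. *)
Definition waiting (T : Type) (n : nat) (q : T -> nat) (w : T) : nat :=
  (q w - n)%N.

Definition cond_prob d (T : measurableType d) (R : realType)
    (P : probability T R) (B A : set T) : \bar R :=
  (P (B `&` A) / P A)%E.

Definition cond_expectation d (T : measurableType d) (R : realType)
    (P : probability T R) (X : T -> R) (A : set T) : \bar R :=
  ((\int[P]_(w in A) (X w)%:E) / P A)%E.

Definition cond_law d (T : measurableType d) (R : realType)
    (P : probability T R) (X : T -> R) (A : set T) (B : set R) : \bar R :=
  cond_prob P (X @^-1` B) A.

(* Pointwise convergence of the distribution functions at the continuity
   points of the limit; [nu_ n] and [nu] are laws on [R]. *)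
Definition cvg_in_distribution (R : realType)
    (nu_ : nat -> set R -> \bar R) (nu : set R -> \bar R) : Prop :=
  forall x : R, {for x, continuous (fun y : R => nu `]-oo, y]%classic)} ->
    nu_ n `]-oo, x]%classic @[n --> \oo] --> nu `]-oo, x]%classic.

(* Main.v *)
(* For each state [i], [1 - P_h(i, i)] is subadditive in [h], hence bounded by
   the exit rate of [i] times [h]. The exit rates of the M/M/n chain are
   bounded, so dominated convergence turns stationarity into the cut equations
   [pi (k + 1) * min(k + 1, n) mu = pi k * lam]. Above level [n] the stationary
   law is therefore geometric with ratio [1 - eps n], that is,
   [P (w > m | w > 0) = (1 - eps n) ^ m]. The moment generating function is then
   a geometric series, and the event [eps w >= x] is [w > m] for the [m] such
   that [m < x / eps <= m + 1], while
   [exp (- theta_n x) = (1 - eps) ^ (x / eps)]. *)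
Require Import Defs.
From mathcomp Require Import ring lra zify.
Set Implicit Arguments.
Unset Strict Implicit.
Unset Printing Implicit Defensive.
Local Open Scope classical_set_scope.
Local Open Scope ring_scope.

(** * Subadditive functions and probability kernels on the naturals *)

(** Cutting [t] into [n.+1] equal steps [u] gives [f t <= n.+1 * f u = t * (f u / u)], and [f u / u]
    tends to [r] as [n] grows. *)
Lemma subadditive_le_rate (R : realType) (f : R -> R) (r : R) :
  (forall s t, 0 <= s -> 0 <= t -> f (s + t) <= f s + f t) ->
  f h / h @[h --> 0^'+] --> r ->
  forall t, 0 < t -> f t <= r * t.
Proof.
move=> fD f0r t t0.
have fM n s : 0 <= s -> f (n.+1%:R * s) <= n.+1%:R * f s.
  move=> s0; elim: n => [|n IH]; first by rewrite !mul1r.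
  rewrite -addn1 natrD !mulrDl !mul1r (le_trans (fD _ _ _ _)) ?mulr_ge0//.
  exact: lerD.
have tn0 n : 0 < t * harmonic n by rewrite mulr_gt0 ?harmonic_gt0.
have tn_cvg : t * harmonic n @[n --> \oo] --> 0.
  by rewrite -[X in _ --> X](mulr0 t); apply: cvgMl_tmp; exact: cvg_harmonic.
have /cvg_at_rightP/(_ _ (conj tn0 tn_cvg)) fr := f0r.
rewrite -ler_pdivrMr//; apply: (cvgr_to_ge fr); apply: nearW => n /=.
have u0 := tn0 n; set u := t * _ in u0 *.
have tE : t = n.+1%:R * u by rewrite /u mulrCA mulfV ?mulr1// pnatr_eq0.
rewrite ler_pdivrMr// mulrAC ler_pdivlMr// [in leRHS]tE [leRHS]mulrA ler_pM2r//.
by rewrite mulrC tE fM// ltW.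
Qed.

Lemma bounded_integrable_nat (R : realType) (pi : probability nat R)
    (f : nat -> R) (M : R) :
  (forall i, `|f i| <= M) -> pi.-integrable setT (EFin \o f).
Proof.
move=> fM; apply: (@le_integrable _ _ _ _ _ _ _ (cst M%:E)) => //.
  by move=> i _ /=; rewrite lee_fin (le_trans (fM i))// ler_norm.
exact: finite_measure_integrable_cst.
Qed.

Section kernel_on_nat.
Context (R : realType) (P : R.-pker nat ~> nat).

Lemma pker_fin_num i A : P i A \is a fin_num.
Proof. exact: finite_kernel_measure. Qed.

Lemma pker_setC i A : fine (P i (~` A)) = 1 - fine (P i A).
Proof.
have := @prob_kernel _ _ _ _ _ P i.
rewrite -(setvU A) measureU ?setICl// => /(congr1 fine).
by rewrite fineD ?pker_fin_num//= => <-; rewrite addrK.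
Qed.

Lemma pker_le i A B : A `<=` B -> fine (P i A) <= fine (P i B).
Proof.
by move=> AB; rewrite fine_le ?pker_fin_num// le_measure ?inE.
Qed.

Lemma pker_le1 i A : fine (P i A) <= 1.
Proof.
by have := pker_le i (@subsetT _ A); rewrite prob_kernel.
Qed.

Lemma pker_below i k :
  fine (P i [set j | (j <= k)%N]) = \sum_(j < k.+1) fine (P i [set j : nat]).
Proof.
elim: k => [|k IH].
  rewrite big_ord1; congr (fine (P i _)).
  by apply/seteqP; split => j /=; rewrite leqn0 => /eqP.
rewrite big_ord_recr/= -IH -fineD ?pker_fin_num// -measureU//; last first.
  by apply/seteqP; split => j //= [/[swap] ->]; rewrite ltnn.
congr (fine (P i _)); apply/seteqP; split => j /=.
  by rewrite leq_eqVlt => /predU1P[->|]; [right|left].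
by case=> [/leqW|->].
Qed.

(** Entering or leaving [A] requires leaving [i]; the bound does not depend on [A]. *)
Lemma pker_jump_le i A :
  `|fine (P i A) - (i \in A)%:R| <= 1 - fine (P i [set i]).
Proof.
have [iA|iA] := boolP (i \in A).
  rewrite ler0_norm ?subr_le0 ?pker_le1// opprB lerD2l lerN2.
  by apply: pker_le => _ ->; exact: set_mem.
rewrite subr0 ger0_norm ?fine_ge0// -pker_setC; apply: pker_le => j Aj /= ji.
by move: iA; rewrite -ji mem_set.
Qed.

End kernel_on_nat.

(** * Flow balance across a cut for a stationary law *)

Section stationary_cut.
Context (R : realType) (P : R -> R.-pker nat ~> nat) (Q : nat -> nat -> R).
Hypothesis PT : transition_function P.
Hypothesis PQ : has_rates P Q.

(** One way to be in [i] at time [s + t] is to be there at time [s] as well: the Chapman-Kolmogorov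
    integral is restricted to [[set i]]. *)
Lemma transition_stay i s t : 0 <= s -> 0 <= t ->
  fine (P s i [set i]) * fine (P t i [set i]) <= fine (P (s + t) i [set i]).
Proof.
move=> s0 t0; rewrite -fineM ?pker_fin_num// fine_le ?fin_numM ?pker_fin_num//.
rewrite PT.2// (le_trans _ (@ge0_subset_integral _ _ _ _ [set i] _ _ _ _ _ _ _))//.
rewrite (eq_integral (cst (P t i [set i]))); last first.
  by move=> j; rewrite inE => ->.
by rewrite integral_cst//= muleC.
Qed.

(** For [a], [b] in [0, 1], [1 - a * b <= (1 - a) + (1 - b)], which makes the left side subadditive
    in [h]. The bound holds for every [h], as domination requires. *)
Lemma transition_exit_le i h : 0 < h -> 1 - fine (P h i [set i]) <= - Q i i * h.
Proof.
apply: (@subadditive_le_rate _ (fun h => 1 - fine (P h i [set i]))).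
  move=> s t s0 t0; have := transition_stay i s0 t0.
  have := pker_le1 (P s) i [set i]; have := pker_le1 (P t) i [set i].
  by nra.
under eq_fun do rewrite /= -opprB mulNr.
by apply: cvgN; have := @PQ i i; rewrite eqxx.
Qed.

(** The set [{0, ..., k}] is finite, so the entrywise limits can be summed without any
    uniformity. *)
Lemma transition_below_rate i k :
  (fine (P h i [set j | (j <= k)%N]) - (i <= k)%:R) / h @[h --> 0^'+] -->
  \sum_(j < k.+1) Q i j.
Proof.
have E : (i <= k)%:R = \sum_(j < k.+1) (i == j)%:R :> R.
  have [ik|ki] := leqP i k.
    rewrite (bigD1 (Ordinal (ik : (i < k.+1)%N)))//= eqxx big1 ?addr0// => j.
    by rewrite -val_eqE/= eq_sym => /negbTE ->.
  by rewrite big1// => j _; rewrite gtn_eqF// (leq_ltn_trans _ ki)// -ltnS.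
under eq_fun do rewrite pker_below E -sumrB mulr_suml.
apply: cvg_big => [|j _]; first exact: add_continuous.
exact: (@PQ i j).
Qed.

Context (pi : probability nat R) (C : R).
Hypothesis pi_stationary : stationary P pi.
Hypothesis exit_bounded : forall i, - Q i i <= C.

(* The net flow into [{0, ..., k}] over a time [h] has mean 0; since exit rates
   are bounded, it is O(h) uniformly in the initial state, and dominated
   convergence gives the flow balance in terms of the rates. *)
Lemma stationary_flow k :
  (\int[pi]_i (\sum_(j < k.+1) Q i j)%:E = 0)%E.
Proof.
pose A : set nat := [set j | (j <= k)%N].
pose g h i : R := (fine (P h i A) - (i <= k)%:R) / h.
have inA i : (i \in A) = (i <= k)%N by apply/idP/idP; rewrite inE.
have g_le h i : 0 < h -> `|g h i| <= C.
  move=> h0; rewrite /g normrM normfV (gtr0_norm h0) ler_pdivrMr// -inA.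
  rewrite (le_trans (pker_jump_le _ _ _))// (le_trans (transition_exit_le _ h0))//.
  by rewrite ler_pM2r.
have g_mean0 h : 0 < h -> (\int[pi]_i (g h i)%:E = 0)%E.
  move=> h0.
  have -> : (\int[pi]_i (g h i)%:E =
      \int[pi]_i (h^-1%:E * ((fine (P h i A))%:E - (i <= k)%:R%:E)))%E.
    by apply: eq_integral => i _; rewrite /g mulrC.
  have iP : pi.-integrable setT (EFin \o (fun i => fine (P h i A))).
    apply: (@bounded_integrable_nat _ _ _ 1) => i.
    by rewrite ger0_norm ?pker_le1// fine_ge0.
  have iA : pi.-integrable setT (EFin \o (fun i : nat => (i <= k)%:R : R)).
    by apply: (@bounded_integrable_nat _ _ _ 1) => i; case: leqP; rewrite ?normr1 ?normr0.
  rewrite integralZl//; last exact: integrableB.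
  (* Both terms have mean [pi A], the first by stationarity and the second as the indicator of
     [A]. *)
  rewrite integralB_EFin// [X in (_ * (X - _))%E](_ : _ = pi A); last first.
    rewrite -(pi_stationary (ltW h0)).
    by apply: eq_integral => i _; rewrite fineK ?pker_fin_num.
  rewrite [X in (_ * (_ - X))%E](_ : _ = pi A); last first.
    under eq_integral do rewrite -inA -indicE.
    by rewrite integral_indic// setIT.
  by rewrite subee ?mule0// fin_num_measure.
have [| | | | |_ _] := @dominated_convergence _ _ _ pi setT measurableT
    (fun n i => (g (harmonic n) i)%:E) (fun i => (\sum_(j < k.+1) Q i j)%:E)
    (cst C%:E) => //.
- apply/aeW => i _; apply: cvg_EFin; first by near=> n.
  have /cvg_at_rightP := @transition_below_rate i k.
  apply; split; [exact: harmonic_gt0|exact: cvg_harmonic].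
- exact: finite_measure_integrable_cst.
- by apply/aeW => i n _; rewrite lee_fin g_le// harmonic_gt0.
rewrite (_ : [sequence _]_n = cst 0%E); last first.
  by apply/funext => n; rewrite /= g_mean0// harmonic_gt0.
move=> cv; apply: (@cvg_unique _ _ _ _ _ _ cv) => //; exact: cvg_cst.
Unshelve. all: by end_near. Qed.

End stationary_cut.

Lemma cvg_cst_eq (R : realType) (c l : R) : c @[_ --> \oo] --> l -> c = l.
Proof. by move=> /cvg_lim <- //; rewrite lim_cst. Qed.

(** * Cut equations of the M/M/n queue *)

(** Jumps have size one, so only [k] and [k.+1] send mass across the cut. For [i < k] the sum
    contains the whole row, which vanishes; for [i > k.+1] it contains no nonzero entry. *)
Lemma mmn_rates_flow (R : realType) n (lam mu : R) i k :
  \sum_(j < k.+1) mmn_rates n lam mu i j =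
  (minn k.+1 n)%:R * mu * (i == k.+1)%:R - lam * (i == k)%:R.
Proof.
elim: k => [|k IH].
  rewrite big_ord1 /mmn_rates/=; case: i => [|[|i]]//=.
  - by rewrite min0n mul0r addr0 mulr0 mulr1 sub0r.
  - by rewrite mulr1 mulr0 subr0.
  - by rewrite !mulr0 subr0.
rewrite big_ord_recr/= IH /mmn_rates eqSS (eq_sym k).
have [->|ik] := eqVneq i k.
  by rewrite !ltn_eqF// !mulr0 mulr1 !sub0r oppr0 addNr.
have [->|ik2] := eqVneq i k.+2; first by rewrite gtn_eqF// !mulr0 mulr1 subr0 add0r subr0.
have [->|ik1] := eqVneq i k.+1; last by rewrite !mulr0 subr0 addr0.
by rewrite !mulr0 !mulr1; ring.
Qed.

Lemma mmn_exit_le (R : realType) n (lam mu : R) i : 0 <= mu ->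
  - mmn_rates n lam mu i i <= lam + n%:R * mu.
Proof.
move=> mu0; rewrite /mmn_rates ltn_eqF// eqxx opprK lerD2l ler_wpM2r//.
by rewrite ler_nat geq_minr.
Qed.

Section mmn_stationary.
Context (R : realType) (n : nat) (lam mu : R) (P : R -> R.-pker nat ~> nat).
Context (pi : probability nat R).
Hypotheses (mu_gt0 : 0 < mu) (mmnP : mmn_chain n lam mu P).
Hypothesis pi_stationary : stationary P pi.

(** The flow is a combination of the indicators of [k.+1] and [k], so its zero mean relates just two
    point masses. *)
Lemma mmn_balance k :
  (minn k.+1 n)%:R * mu * fine (pi [set k.+1]) = lam * fine (pi [set k]).
Proof.
have := stationary_flow mmnP.1 mmnP.2 pi_stationary
  (fun i => mmn_exit_le n lam i (ltW mu_gt0)) k.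
have indE (i j : nat) : (i == j)%:R = \1_[set j] i :> R.
  by rewrite indicE; congr (nat_of_bool _)%:R; apply/idP/idP; rewrite inE => /eqP.
under eq_integral do rewrite mmn_rates_flow !indE.
have int_ind (c : R) j : pi.-integrable setT (EFin \o (fun i => c * \1_[set j] i)).
  apply: (@bounded_integrable_nat _ _ _ `|c|) => i.
  by rewrite indicE normrM; case: (_ \in _); rewrite ?normr1 ?normr0 ?mulr1 ?mulr0.
have intE (c : R) j : (\int[pi]_i (c * \1_[set j] i)%:E = c%:E * pi [set j])%E.
  rewrite (eq_integral (fun i => (c%:E * (\1_[set j] i)%:E)%E))//.
  by rewrite integralZl ?integral_indic ?setIT//; have := int_ind 1 j; under eq_fun do rewrite mul1r.
rewrite integralB_EFin//= !intE => /eqP.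
rewrite sube_eq ?add0e ?fin_numM ?fin_num_measure//.
by move=> /eqP/(congr1 fine); rewrite !fineM ?fin_num_measure.
Qed.
End mmn_stationary.

(** * From a ratio between successive masses to a geometric tail *)

Section geometric_tail.
Context (R : realType) (pi : probability nat R).
Let p k := fine (pi [set k]).
Let t m := fine (pi [set k | (m <= k)%N]).

Lemma tail_succ m : t m = p m + t m.+1.
Proof.
rewrite /t /p -fineD ?fin_num_measure// -measureU//; last first.
  by apply/seteqP; split => k //= [->]; rewrite ltnn.
congr (fine (pi _)); apply/seteqP; split => k /=.
  by rewrite leq_eqVlt => /predU1P[->|]; [left|right].
by case=> [->|/ltnW].
Qed.

Lemma tail_cvg0 : t m @[m --> \oo] --> 0.
Proof.
apply: fine_cvg.
have -> : 0%:E = pi (\bigcap_m [set k | (m <= k)%N]).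
  rewrite (_ : \bigcap_m _ = set0) ?measure0//.
  by apply/seteqP; split => // k /(_ k.+1 I) /=; rewrite ltnn.
apply: nonincreasing_cvg_mu => //.
  by rewrite ltey_eq fin_num_measure.
by move=> m m' mm'; apply/subsetPset => k; exact: leq_trans.
Qed.

(** If [p 0] vanished, so would every [p k]; all tails would then equal 1, while they tend to 0. *)
Lemma mass_pos : (forall k, p k = 0 -> p k.+1 = 0) -> 0 < p 0.
Proof.
move=> pS; rewrite lt_neqAle fine_ge0// andbT; apply/eqP => /esym p0.
have p_eq0 k : p k = 0 by elim: k => [|k /pS].
have t1 m : t m = 1.
  elim: m => [|m]; last by rewrite tail_succ p_eq0 add0r.
  rewrite /t (_ : [set _ | _] = setT) ?probability_setT//.
  by apply/seteqP; split.
have := tail_cvg0; under eq_fun do rewrite t1.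
by move=> /cvg_cst_eq /eqP; rewrite oner_eq0.
Qed.

(** The quantity [(1 - r) * t (n + m) - p (n + m)] is constant in [m] and tends to 0, the masses
    being differences of consecutive tails; hence it is 0. *)
Lemma tail_geometric n r : (forall k, (n <= k)%N -> p k.+1 = r * p k) ->
  forall m, (1 - r) * t (n + m)%N = r ^+ m * p n.
Proof.
move=> pS.
have pE m : p (n + m)%N = r ^+ m * p n.
  elim: m => [|m IH]; first by rewrite addn0 mul1r.
  by rewrite addnS pS ?leq_addr// IH mulrA -exprS.
pose u m := (1 - r) * t (n + m)%N - p (n + m)%N.
have uS m : u m = u 0.
  elim: m => [//|m <-]; rewrite /u addnS (tail_succ (n + m)%N) pS ?leq_addr//.
  by ring.
have tn0 : t (n + m)%N @[m --> \oo] --> 0.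
  under eq_fun do rewrite addnC.
  by have := tail_cvg0; rewrite -(cvg_shiftn n).
have pn0 : p (n + m)%N @[m --> \oo] --> 0.
  have -> : (fun m => p (n + m)%N) = (fun m => t (n + m)%N - t (n + m.+1)%N).
    by apply/funext => m; rewrite addnS (tail_succ (n + m)%N) addrK.
  rewrite -[X in _ --> X](subr0 0); apply: cvgB => //.
  by have := tn0; rewrite -cvg_shiftS.
have : u m @[m --> \oo] --> (1 - r) * 0 - 0 by apply: cvgB => //; apply: cvgMl_tmp.
rewrite mulr0 subr0; under eq_fun do rewrite uS.
move=> /cvg_cst_eq u0 m.
by rewrite -pE; apply/eqP; rewrite -subr_eq0 -/(u m) uS u0.
Qed.

End geometric_tail.

(** * Scaled variables with a geometric tail *)

Section geometric_rv.
Context d (T : measurableType d) (R : realType) (P : probability T R).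
Context (w : T -> nat) (e c : R).
Hypotheses (mw : forall A : set nat, measurable (w @^-1` A)).
Hypotheses (e_gt0 : 0 < e) (e_lt1 : e < 1) (c_gt0 : 0 < c).
(** At [m = 0] this identifies [c] as the probability of [pos]. *)
Hypothesis tailP : forall m, P [set s | (m < w s)%N] = (c * (1 - e) ^+ m)%:E.

Let pos : set T := [set s | (0 < w s)%N].
Let th : R := e^-1 * ln (1 - e)^-1.

Lemma cond_prob_tail m :
  cond_prob P [set s | (m < w s)%N] pos = ((1 - e) ^+ m)%:E.
Proof.
rewrite /cond_prob (_ : _ `&` pos = [set s | (m < w s)%N]); last first.
  by apply/seteqP; split => s /= => [[]//|ms]; split => //; exact: leq_ltn_trans ms.
rewrite !tailP mulr1 inver gt_eqF// -EFinM.
by rewrite mulrAC mulfV ?mul1r// gt_eqF.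
Qed.

(** Replacing the exponent [x / e] by [m] lowers it by at most 1, which costs at most one factor
    [(1 - e)^-1]. Both inequalities on [m] are weak, so that rounding by floor or by ceiling minus
    one is covered. *)
Lemma geometric_bounds m x : m%:R <= x / e <= m.+1%:R ->
  expR (- th * x) <= (1 - e) ^+ m <= (1 - e)^-1 * expR (- th * x).
Proof.
have e1 : 0 < 1 - e by rewrite subr_gt0.
move=> /andP[mx xm].
have -> : (1 - e) ^+ m = expR (m%:R * ln (1 - e)).
  by rewrite expRM_natl lnK.
have -> : (1 - e)^-1 = expR (- ln (1 - e)) by rewrite expRN lnK.
have l0 : ln (1 - e) <= 0 by rewrite ln_le0// gerBl ltW.
have -> : - th * x = (x / e) * ln (1 - e).
  by rewrite /th lnV//; ring.
rewrite -expRD !ler_expR ler_wnM2r//=.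
move: xm; rewrite -natr1 -subr_ge0 => xm.
by have := mulr_ge0_le0 xm l0; lra.
Qed.

Let scale_lt x m : (x < e * m%:R) = (x / e < m%:R).
Proof. by rewrite ltr_pdivrMr// mulrC. Qed.

Let scale_le x m : (x <= e * m%:R) = (x / e <= m%:R).
Proof. by rewrite ler_pdivrMr// mulrC. Qed.

(** Here [m] is the ceiling of [x / e] minus one, a natural number because [x] is positive. *)
Lemma ge_tailE x : 0 < x -> exists2 m,
  m%:R <= x / e <= m.+1%:R &
  [set s | x <= e * (w s)%:R] = [set s | (m < w s)%N].
Proof.
move=> x0; have y0 : 0 < x / e by rewrite divr_gt0.
have ex_m : exists m, x / e <= m.+1%:R.
  exists (Num.truncn (x / e)); exact/ltW/truncnS_gt.
case: (ex_minnP ex_m) => m ym m_min.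
have my : m%:R < x / e.
  case: m ym m_min => // m _ m_min; rewrite ltNge; apply/negP => /m_min.
  by rewrite ltnn.
exists m; first by rewrite ym ltW.
apply/seteqP; split => s /=; rewrite scale_le.
  by move=> /(lt_le_trans my); rewrite ltr_nat.
by move=> ms; rewrite (le_trans ym)// ler_nat.
Qed.

(** With the strict inequality, [m] is the floor of [x / e]; this version serves the distribution
    function, whose complement is a strict tail. *)
Lemma gt_tailE x : 0 <= x -> exists2 m,
  m%:R <= x / e <= m.+1%:R &
  [set s | x < e * (w s)%:R] = [set s | (m < w s)%N].
Proof.
move=> x0; have y0 : 0 <= x / e by rewrite divr_ge0// ltW.
exists (Num.truncn (x / e)); first by rewrite truncn_le// y0 ltW// truncnS_gt.
apply/seteqP; split => s /=; rewrite scale_lt.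
  rewrite -(ltr_nat R); apply: le_lt_trans.
  by rewrite truncn_le.
move=> ms; rewrite (lt_le_trans (truncnS_gt _))// ler_nat//.
Qed.

Lemma cond_prob_ge_bounds x : 0 < x ->
  ((expR (- th * x))%:E <= cond_prob P [set s | (x <= e * (w s)%:R)%R] pos)%E /\
  (cond_prob P [set s | (x <= e * (w s)%:R)%R] pos <=
     ((1 - e)^-1 * expR (- th * x))%:E)%E.
Proof.
move=> /ge_tailE[m /geometric_bounds/andP[lb ub] ->].
by rewrite cond_prob_tail !lee_fin.
Qed.

(** Removing the conditioning only multiplies by [c], which is invisible at the scale of exponential
    decay. *)
Lemma prob_geE x : 0 < x -> P [set s | x <= e * (w s)%:R] =
  (c%:E * cond_prob P [set s | (x <= e * (w s)%:R)%R] pos)%E.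
Proof. by move=> /ge_tailE[m _ ->]; rewrite cond_prob_tail tailP -EFinM. Qed.

Lemma cond_law_bounds x : 0 <= x ->
  ((1 - (1 - e)^-1 * expR (- th * x))%:E <=
    cond_law P (fun s => (e * (w s)%:R)%R) pos `]-oo, x])%E /\
  (cond_law P (fun s => (e * (w s)%:R)%R) pos `]-oo, x] <=
    (1 - expR (- th * x))%:E)%E.
Proof.
move=> /gt_tailE[m /geometric_bounds/andP[lb ub] xE].
suff -> : cond_law P (fun s => (e * (w s)%:R)%R) pos `]-oo, x] =
    (1 - (1 - e) ^+ m)%:E by rewrite !lee_fin !lerD2l !lerN2.
have posE : P pos = c%:E by rewrite tailP mulr1.
rewrite /cond_law /cond_prob posE inver gt_eqF//.
rewrite (_ : _ `&` pos = pos `\` [set s | (m < w s)%N]); last first.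
  rewrite -xE; apply/seteqP; split => s /=; rewrite in_itv/= => -[].
    by move=> ex ps; split => //; apply/negP; rewrite -leNgt.
  by move=> ps /negP; rewrite -leNgt.
rewrite measureD//; last 3 first.
- exact: (mw [set k | (0 < k)%N]).
- exact: (mw [set k | (m < k)%N]).
- by rewrite -[X in (X < _)%E]/(P pos) posE ltry.
rewrite (_ : _ `&` _ = [set s | (m < w s)%N]); last first.
  by apply/seteqP; split => s /= => [[]//|ms]; split => //; exact: leq_ltn_trans ms.
rewrite -[X in (X - _)%E]/(P pos) -[X in (_ - X)%E]/(P [set s | (m < w s)%N]).
rewrite posE tailP -EFinB -EFinM; congr (_%:E).
by field; rewrite gt_eqF.
Qed.

Lemma cond_law_lt0 x : x < 0 ->
  cond_law P (fun s => (e * (w s)%:R)%R) pos `]-oo, x] = 0%E.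
Proof.
move=> x0; rewrite /cond_law /cond_prob (_ : _ @^-1` _ = set0).
  by rewrite set0I measure0 mul0e.
apply/seteqP; split => s //=; rewrite in_itv/= => /le_lt_trans /(_ x0).
by rewrite ltNge mulr_ge0// ltW.
Qed.

Lemma point_mass m : P [set s | w s = m.+1] = (c * (e * (1 - e) ^+ m))%:E.
Proof.
rewrite (_ : [set _ | _] = [set s | (m < w s)%N] `\` [set s | (m.+1 < w s)%N]).
  rewrite measureD//; last 3 first.
  - exact: (mw [set k | (m < k)%N]).
  - exact: (mw [set k | (m.+1 < k)%N]).
  - by rewrite -[X in (X < _)%E]/(P [set s | (m < w s)%N]) tailP ltry.
  rewrite (_ : _ `&` _ = [set s | (m.+1 < w s)%N]); last first.
    by apply/seteqP; split => s /= => [[]//|ms]; split => //; exact: ltnW.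
  rewrite -[X in (X - _)%E]/(P [set s | (m < w s)%N]).
  rewrite -[X in (_ - X)%E]/(P [set s | (m.+1 < w s)%N]).
  by rewrite !tailP -EFinB exprS; congr (_%:E); ring.
apply/seteqP; split => s /=; first by move=> ->; rewrite ltnS leqnn ltnn.
by move=> -[ms /negP]; rewrite -leqNgt => sm; apply/eqP; rewrite eqn_leq sm.
Qed.

(** Splitting [pos] by the value of [w] gives a geometric series of ratio [(1 - e) * expR u], in
    which [c] cancels against the probability of [pos]. *)
Lemma cond_expectation_exp u : (1 - e) * expR u < 1 ->
  cond_expectation P (fun s => expR (u * (w s)%:R)) pos =
    (e * expR u / (1 - (1 - e) * expR u))%:E.
Proof.
move=> lt1; have e1 : 0 < 1 - e by rewrite subr_gt0.
pose z := (1 - e) * expR u; have z0 : 0 < z by rewrite mulr_gt0// expR_gt0.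
have posE : pos = \bigcup_m [set s | w s = m.+1].
  rewrite /pos; apply/seteqP; split => s /=; last by case=> m _ /= ->.
  by case E : (w s) => [//|m] _; exists m.
have int_piece m : (\int[P]_(s in [set s | w s = m.+1]) (expR (u * (w s)%:R))%:E
    = (geometric (c * (e * expR u)) z m)%:E)%E.
  rewrite (eq_integral (cst (expR (u * m.+1%:R))%:E)); last first.
    by move=> s; rewrite inE/= => ->.
  rewrite integral_cst; last exact: (mw [set m.+1]).
  rewrite -[X in (_ * X)%E]/(P [set s | w s = m.+1]) point_mass -EFinM /=; congr (_%:E).
  by rewrite (mulrC u) expRM_natl exprS /z exprMn; ring.
rewrite /cond_expectation -/pos tailP mulr1 inver gt_eqF// posE.
rewrite ge0_integral_bigcup//; last 3 first.
- by move=> m; exact: (mw [set m.+1]).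
(* Any function of [w] is measurable, since every set of naturals has a measurable preimage under
   [w]. *)
- rewrite -posE => _ B _.
  exact: (mw [set k | (0 < k)%N /\ B (expR (u * k%:R))%:E]).
- by move=> i j _ _ [s /= [-> []]].
under eq_eseriesr do rewrite int_piece.
have -> : (\big[+%E/0]_(0 <= i <oo) (geometric (c * (e * expR u)) z i)%:E =
    (c * (e * expR u) / (1 - z))%:E)%E.
  apply/cvg_lim => //.
  under eq_fun do rewrite sumEFin.
  apply: cvg_EFin; first by near=> k.
  by apply: cvg_geometric_series; rewrite gtr0_norm.
rewrite -EFinM; congr (_%:E); rewrite /z; field.
by apply/andP; split; rewrite gt_eqF// subr_gt0.
Unshelve. all: by end_near. Qed.

End geometric_rv.

(** * Limits as the load tends to 1 *)

(** Multiply [1 - y <= expR (- y)] by [expR y]. *)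
Lemma expR_sub1_le (R : realType) (y : R) : expR y - 1 <= y * expR y.
Proof.
have := ler_wpM2r (expR_ge0 y) (expR_ge1Dx (- y)).
by rewrite -expRD addNr expR0; lra.
Qed.

Section heavy_traffic_limits.
Context (R : realType) (e : nat -> R).
Hypothesis e01 : \forall n \near \oo, 0 < e n < 1.
Hypothesis e_cvg0 : e n @[n --> \oo] --> 0.

(** The bound [ln y <= y - 1], taken at [1 - e n] and at its inverse, squeezes the quotient between
    1 and [(1 - e n)^-1]. *)
Lemma decay_rate_cvg1 : (e n)^-1 * ln (1 - e n)^-1 @[n --> \oo] --> (1 : R).
Proof.
have inv1 : (1 - e n)^-1 @[n --> \oo] --> (1 : R).
  rewrite -[X in _ --> X]invr1; apply: cvgV; first by rewrite oner_neq0.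
  by rewrite -[X in _ --> X]subr0; apply: cvgB => //; exact: cvg_cst.
apply: (@squeeze_cvgr _ _ _ _ (cst 1) (fun n => (1 - e n)^-1)) => //; last exact: cvg_cst.
near=> n; have /andP[e0 e1] : 0 < e n < 1 by near: n.
have e1' : 0 < 1 - e n by rewrite subr_gt0.
rewrite /= mulrC ler_pdivlMr// ler_pdivrMr// mul1r; apply/andP; split.
  have := @le_ln1Dx R (- e n); rewrite ltrN2 => /(_ e1).
  by rewrite lnV// lerNr.
have := @le_ln1Dx R ((1 - e n)^-1 - 1).
rewrite addrCA subrr addr0 ltrBrDl subrr invr_gt0 => /(_ e1') /le_trans; apply.
rewrite le_eqVlt; apply/orP; left; apply/eqP; field.
by rewrite gt_eqF.
Unshelve. all: by end_near. Qed.

(** Numerator and denominator both vanish in the limit. Dividing them by [e n] leaves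
    [E / (E - (E - 1) / e n)], where [(E - 1) / e n] lies between [theta] and [theta * E], whatever
    the sign of [theta]. *)
Lemma mgf_cvg (theta : R) : theta < 1 ->
  e n * expR (theta * e n) / (1 - (1 - e n) * expR (theta * e n))
    @[n --> \oo] --> (1 - theta)^-1.
Proof.
move=> th1; pose E n := expR (theta * e n).
have E1 : E n @[n --> \oo] --> (1 : R).
  have e_theta0 : theta * e n @[n --> \oo] --> theta * 0 by apply: cvgMl_tmp.
  rewrite -[1]expR0 -(mulr0 theta).
  exact: (continuous_cvg _ (@continuous_expR R _) e_theta0).
have D : (E n - 1) / e n @[n --> \oo] --> theta.
  apply: (@squeeze_cvgr _ _ _ _ (cst theta) (fun n => theta * E n)).
  - near=> n; have /andP[e0 e1] : 0 < e n < 1 by near: n.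
    rewrite /= ler_pdivlMr// ler_pdivrMr//; apply/andP; split.
      by rewrite lerBrDl expR_ge1Dx.
    by rewrite mulrAC expR_sub1_le.
  - exact: cvg_cst.
  - by rewrite -[X in _ --> X](mulr1 theta); apply: cvgMl_tmp.
have C : E n / (E n - (E n - 1) / e n) @[n --> \oo] --> (1 - theta)^-1.
  rewrite -[X in _ --> X]mul1r; apply: cvgM => //; apply: cvgV.
    by rewrite gt_eqF// subr_gt0.
  exact: cvgB.
apply: cvg_trans C; apply: near_eq_cvg; near=> n.
have /andP[e0 e1] : 0 < e n < 1 by near: n.
rewrite -/(E n).
have -> : 1 - (1 - e n) * E n = e n * (E n - (E n - 1) / e n).
  by field; rewrite gt_eqF.
by rewrite invfM mulrACA divff ?gt_eqF// mul1r.
Unshelve. all: by end_near. Qed.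

End heavy_traffic_limits.

(** As [theta * e < e], [1 - e < 1 - theta * e <= expR (- (theta * e))]; this is the convergence
    condition of the geometric series. *)
Lemma mgf_finite (R : realType) (theta e : R) : theta < 1 -> 0 < e ->
  (1 - e) * expR (theta * e) < 1.
Proof.
move=> th1 e0; rewrite -ltr_pdivlMr ?expR_gt0// mul1r -expRN.
apply: lt_le_trans (expR_ge1Dx _).
by rewrite ltrD2l ltrN2 gtr_pMl.
Qed.

(** * The exponential law and exponential decay rates *)

Lemma exponential_cdf (R : realType) (x : R) :
  exponential_prob 1 `]-oo, x] = (if 0 <= x then 1 - expR (- x) else 0)%:E.
Proof.
have nnegE (D : set R) :
    exponential_prob 1 D = exponential_prob 1 (D `&` `[0, +oo[).
  rewrite /exponential_prob integral_mkcondr; apply: eq_integral => y _.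
  rewrite patchE; case: ifPn => // y0.
  by rewrite /exponential_pdf patchE (negbTE y0).
rewrite nnegE; case: ltrgt0P => [x0|x0|->].
- rewrite (_ : _ `&` _ = `[0, x]%classic).
    by rewrite exponential_prob_itv0c// mulN1r.
  by apply/seteqP; split => y /=; rewrite !in_itv/= ?andbT; [case=> -> ->|case/andP].
- rewrite (_ : _ `&` _ = set0) ?/exponential_prob ?integral_set0//.
  apply/seteqP; split => y //=; rewrite !in_itv/= andbT => -[yx].
  by rewrite leNgt (le_lt_trans yx).
- rewrite oppr0 expR0 subrr (_ : _ `&` _ = [set 0]) ?/exponential_prob ?integral_set1//.
  apply/seteqP; split => y /=; rewrite !in_itv/= andbT; last by move=> ->.
  by move=> [y0 y0']; apply/eqP; rewrite eq_le y0.
Qed.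

(** A constant factor [c] shifts the quotient by [ln c / x], which tends to 0. *)
Lemma exponential_decay_rate (R : realType) (p : R -> R) (th c1 c2 : R) :
  0 < c1 -> 0 < c2 ->
  (\forall x \near +oo,
    c1 * expR (- th * x) <= p x <= c2 * expR (- th * x)) ->
  - x^-1 * ln (p x) @[x --> +oo] --> th.
Proof.
move=> c10 c20 p_bounds.
have Vcvg (a : R) : th - a / x @[x --> +oo] --> th.
  rewrite -[X in _ --> X]subr0; apply: cvgB; first exact: cvg_cst.
  rewrite -[X in _ --> X](mulr0 a); apply: cvgMl_tmp.
  by apply/gtr0_cvgV0; [exact: nbhs_pinfty_gt|exact: cvg_id].
apply: (squeeze_cvgr _ (Vcvg (ln c2)) (Vcvg (ln c1))).
near=> x; have x0 : 0 < x by near: x; exact: nbhs_pinfty_gt.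
have /andP[lb ub] : c1 * expR (- th * x) <= p x <= c2 * expR (- th * x).
  by near: x.
have lnE (c : R) : 0 < c -> th - ln c / x = - x^-1 * ln (c * expR (- th * x)).
  move=> c0; rewrite lnM ?posrE ?expR_gt0// expRK.
  by field; rewrite gt_eqF.
have p0 : 0 < p x by rewrite (lt_le_trans _ lb)// mulr_gt0 ?expR_gt0.
rewrite !lnE// !mulNr !lerN2 !ler_pM2l ?invr_gt0//.
by rewrite !ler_ln ?posrE ?mulr_gt0 ?expR_gt0// -!mulNr ub lb.
Unshelve. all: by end_near. Qed.

(** * The waiting queue and its asymptotics *)

Lemma mmn_waiting_tail (R : realType) (n : nat) (lam mu e : R)
    (chain : R -> R.-pker nat ~> nat)
    d (T : measurableType d) (P : probability T R) (q : {RV P >-> nat}) :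
  (0 < n)%N -> 0 < mu -> 0 < e -> e < 1 -> lam = n%:R * mu * (1 - e) ->
  mmn_chain n lam mu chain -> stationary chain (distribution P q) ->
  exists2 c, 0 < c &
    forall m, P [set s | (m < waiting n q s)%N] = (c * (1 - e) ^+ m)%:E.
Proof.
move=> n0 mu0 e0 e1 lamE chainP q_stat.
pose pi : probability nat R := distribution P q.
have e1' : 0 < 1 - e by rewrite subr_gt0.
have n0' : 0 < n%:R :> R by rewrite ltr0n.
have lam0 : 0 < lam by rewrite lamE !mulr_gt0.
pose mass k := fine (pi [set k]).
have bal k : (minn k.+1 n)%:R * mu * mass k.+1 = lam * mass k.
  exact: mmn_balance mu0 chainP q_stat k.
have death0 k : 0 < (minn k.+1 n)%:R * mu :> R.
  by rewrite mulr_gt0// ltr0n leq_min n0.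
(* All death rates are positive because [n] is, so a zero mass at [k] forces one at [k.+1]. *)
have mass0 : 0 < mass 0%N.
  apply: mass_pos => k pk0; have := bal k.
  rewrite /mass pk0 mulr0 => /eqP.
  by rewrite mulf_eq0 gt_eqF//= => /eqP.
have mass_gt0 k : 0 < mass k.
  by elim: k => // k IH; rewrite -(pmulr_rgt0 _ (death0 k)) bal mulr_gt0.
have geo k : (n <= k)%N -> mass k.+1 = (1 - e) * mass k.
  move=> nk; have := bal k; rewrite (minn_idPr (leqW nk)) lamE -!mulrA.
  by move=> /(mulfI (lt0r_neq0 n0'))/(mulfI (lt0r_neq0 mu0)).
(* This is the tail of [pi] from [n.+1] on, given by [tail_geometric] with ratio [1 - e]. *)
exists ((1 - e) * mass n / e); first by rewrite divr_gt0 ?mulr_gt0.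
move=> m.
have -> : [set s | (m < waiting n q s)%N] = q @^-1` [set k | (n + m.+1 <= k)%N].
  by apply/seteqP; split => s; rewrite /= /waiting; lia.
rewrite -[LHS]/(pi [set k | (n + m.+1 <= k)%N]) -[LHS]fineK ?fin_num_measure//.
congr (_%:E); have := tail_geometric geo m.+1.
rewrite opprB addrCA subrr addr0 => /(congr1 ( *%R e^-1)).
by rewrite mulKf ?gt_eqF// => ->; rewrite -/(mass n) exprS; ring.
Qed.

(** The constant [1 / (1 - eps n) ^ 2] of the English lower bound exceeds the constant of the upper
    bound, as [0 < eps n < 1], so the two bounds contradict each other. The lower constant here is
    1, the largest valid for all [x > eps n]. *)
Theorem corollary9 (R : realType) (mu : R) (lam eps : nat -> R)
    (chain : nat -> R -> R.-pker nat ~> nat)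
    (d : nat -> measure_display) (T : forall n, measurableType (d n))
    (Pr : forall n, probability (T n) R)
    (q : forall n, {RV (Pr n) >-> nat})
    (w := fun n => waiting n (q n))
    (wpos := fun n => [set s | (0 < w n s)%N])
    (epsw := fun n s => eps n * (w n s)%:R)
    (theta_ := fun n => (eps n)^-1 * ln (1 - eps n)^-1)
    (mu_gt0 : 0 < mu)
    (lamE : forall n, (0 < n)%N -> lam n = n%:R * mu * (1 - eps n))
    (lam_gt0 : forall n, (0 < n)%N -> 0 < lam n)
    (stable : forall n, (0 < n)%N -> lam n < n%:R * mu)
    (mmn : forall n, (0 < n)%N -> mmn_chain n (lam n) mu (chain n))
    (q_stationary : forall n, (0 < n)%N ->
      stationary (chain n) (distribution (Pr n) (q n)))
    (eps_cvg0 : eps n @[n --> \oo] --> 0) :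
  (forall theta : R, theta < 1 ->
    cond_expectation (Pr n) (fun s => expR (theta * epsw n s)) (wpos n)
      @[n --> \oo] --> ((1 - theta)^-1)%:E) /\
  cvg_in_distribution
    (fun n => cond_law (Pr n) (epsw n) (wpos n)) (exponential_prob 1) /\
  (forall n, (0 < n)%N -> forall x : R, eps n < x ->
    ((expR (- theta_ n * x))%:E
       <= cond_prob (Pr n) [set s | (x <= epsw n s)%R] (wpos n))%E /\
    (cond_prob (Pr n) [set s | (x <= epsw n s)%R] (wpos n)
       <= ((1 - eps n)^-1 * expR (- theta_ n * x))%:E)%E) /\
  (forall n, (0 < n)%N ->
    (- x^-1 * ln (fine (Pr n [set s | x <= epsw n s]))
       @[x --> +oo] --> theta_ n) /\
    (- x^-1 * ln (fine (cond_prob (Pr n) [set s | x <= epsw n s] (wpos n)))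
       @[x --> +oo] --> theta_ n)).
Proof.
(* Stability gives [eps n > 0], and a positive arrival rate gives [eps n < 1]. *)
have eps_gt0 n : (0 < n)%N -> 0 < eps n.
  move=> n0; have := stable n n0; rewrite lamE// gtr_pMr ?mulr_gt0 ?ltr0n//.
  by rewrite gtrBl.
have eps_lt1 n : (0 < n)%N -> eps n < 1.
  move=> n0; have := lam_gt0 n n0; rewrite lamE// pmulr_rgt0 ?mulr_gt0 ?ltr0n//.
  by rewrite subr_gt0.
have eps01 : \forall n \near \oo, 0 < eps n < 1.
  near=> n; have n0 : (0 < n)%N by near: n; exact: nbhs_infty_gt.
  by rewrite eps_gt0 ?eps_lt1.
have tail n (n0 : (0 < n)%N) := mmn_waiting_tail n0 mu_gt0 (eps_gt0 n n0)
  (eps_lt1 n n0) (lamE _ n0) (mmn _ n0) (q_stationary _ n0).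
have mw n (A : set nat) : measurable (w n @^-1` A).
  exact: (measurable_funPTI (q n) (I : measurable [set k | A (k - n)%N])).
split; [|split; [|split]].
- move=> theta theta_lt1.
  have /(cvg_comp _ EFin) mgf := mgf_cvg eps01 eps_cvg0 theta_lt1.
  apply: cvg_trans (mgf _ _); last by apply: cvg_EFin => //; near=> r.
  apply: near_eq_cvg; near=> n.
  have n0 : (0 < n)%N by near: n; exact: nbhs_infty_gt.
  have [c c0 tailn] := tail n n0.
  rewrite /= -(cond_expectation_exp (mw n) (eps_lt1 n n0) c0 tailn);
    last exact: mgf_finite (eps_gt0 n n0).
  congr cond_expectation; apply/funext => s.
  by rewrite /epsw mulrA.
(* For [x < 0] both sides vanish; for [x >= 0] the two bounds on the conditional law share the limit
   [1 - expR (- x)]. *)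
- move=> x _; rewrite exponential_cdf; case: ifPn => [x0|]; last first.
    rewrite -ltNge => x0.
    apply: cvg_near_cst; near=> n.
    have n0 : (0 < n)%N by near: n; exact: nbhs_infty_gt.
    by rewrite cond_law_lt0 ?eps_gt0.
  have expr_cvg : expR (- theta_ n * x) @[n --> \oo] --> expR (- x).
    have th_x : - theta_ n * x @[n --> \oo] --> - 1 * x.
      by apply: cvgM; [apply: cvgN; exact: decay_rate_cvg1|exact: cvg_cst].
    rewrite mulN1r in th_x.
    exact: (continuous_cvg _ (@continuous_expR R _) th_x).
  apply: (@squeeze_cvge _ _ _ _
      (fun n => (1 - (1 - eps n)^-1 * expR (- theta_ n * x))%:E) _
      (fun n => (1 - expR (- theta_ n * x))%:E)).
  + near=> n; have n0 : (0 < n)%N by near: n; exact: nbhs_infty_gt.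
    have [c c0 tailn] := tail n n0.
    by apply/andP; exact: cond_law_bounds (mw n) (eps_gt0 n n0) (eps_lt1 n n0) c0 tailn _ x0.
  + apply: cvg_EFin; first by near=> n.
    apply: cvgB; first exact: cvg_cst.
    rewrite -[X in _ --> X]mul1r; apply: cvgM => //.
    rewrite -[X in _ --> X]invr1; apply: cvgV; first exact: oner_neq0.
    rewrite -[X in _ --> X]subr0; apply: cvgB => //; exact: cvg_cst.
  + apply: cvg_EFin; first by near=> n.
    apply: cvgB => //; exact: cvg_cst.
- move=> n n0 x ex; have [c c0 tailn] := tail n n0.
  have x0 : 0 < x := lt_trans (eps_gt0 n n0) ex.
  exact: cond_prob_ge_bounds (eps_gt0 n n0) (eps_lt1 n n0) c0 tailn _ x0.
- move=> n n0; have [c c0 tailn] := tail n n0.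
  have e1 : 0 < (1 - eps n)^-1 by rewrite invr_gt0 subr_gt0 eps_lt1.
  have bounds x : 0 < x ->
      expR (- theta_ n * x) <=
        fine (cond_prob (Pr n) [set s | x <= epsw n s] (wpos n)) <=
      (1 - eps n)^-1 * expR (- theta_ n * x) /\
      fine (Pr n [set s | x <= epsw n s]) =
        c * fine (cond_prob (Pr n) [set s | x <= epsw n s] (wpos n)).
    move=> x0.
    have := cond_prob_ge_bounds (eps_gt0 n n0) (eps_lt1 n n0) c0 tailn x0.
    rewrite (prob_geE (eps_gt0 n n0) c0 tailn x0).
    (* The conditional probability is a power of [1 - eps n], hence finite, so [fine] can be
       computed on both sides. *)
    have [m _ ->] := ge_tailE (w n) (eps_gt0 n n0) x0.
    by rewrite (cond_prob_tail c0 tailn) !lee_fin => -[-> ->].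
  split.
  + apply: (exponential_decay_rate c0 (mulr_gt0 c0 e1)); near=> x.
    have [|/andP[lb ub] ->] := bounds x; first by near: x; exact: nbhs_pinfty_gt.
    by rewrite -mulrA !ler_pM2l// lb ub.
  + apply: (exponential_decay_rate ltr01 e1); near=> x.
    have [|+ _] := bounds x; first by near: x; exact: nbhs_pinfty_gt.
    by rewrite mul1r.
Unshelve. all: by end_near. Qed.
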